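(* Let $n\in\mathbb{N}$. Then $$N_nN_n\subset N_n,\qquad M_nM_n\subset N_n,\qquad M_nN_n\subset M_n,\qquad N_nM_n\subset M_n.$$
   Context: $\sigma_n\in\mathbb{R}^n$ is the column vector with $j$th entry $(-1)^{j-1}$; $X^\bot=\{u\in\mathbb{R}^n\mid u^Tv=0\ (v\in X)\}$. For even $n$, with indices in $\mathbb{Z}_n=\mathbb{Z}/n\mathbb{Z}$ (modulo $n$): $M_n$ is the space of matrices $M\in\mathbb{R}^{n\times n}$ with $M_{i,j}+M_{i,j+1}+M_{i+1,j}+M_{i+1,j+1}=0$ for all $i,j\in\mathbb{Z}_n$ and $\sum_{i,j\in\mathbb{Z}_n}(-1)^{i+j}M_{i,j}=0$; $N_n$ is the space of matrices $M\in\mathbb{R}^{n\times n}$ with $\sum_{i\in\mathbb{Z}_n}(-1)^i(M_{i,j}+M_{i,j+1})=\sum_{i\in\mathbb{Z}_n}(-1)^i(M_{j,i}+M_{j+1,i})=0$ for all $j\in\mathbb{Z}_n$. For odd $n$: $M_n=\{M\in\mathbb{R}^{n\times n}\mid u^TMv=0\ (u,v\in\{\sigma_n\}^\bot),\ \sigma_n^TM\sigma_n=0\}$ and $N_n=\{M\in\mathbb{R}^{n\times n}\mid\sigma_n^TMu=0=u^TM\sigma_n\ (u\in\{\sigma_n\}^\bot)\}$. For sets of matrices $X,Y$, $XY$ denotes the set of matrix products $xy$ with $x\in X$, $y\in Y$. *)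

(* Defs.v *)
(* The real numbers are an arbitrary R : realType. *)
From HB Require Import structures.
From mathcomp Require Import all_boot all_order all_algebra.
From mathcomp Require Import boolp classical_sets reals.
Set Implicit Arguments.
Unset Strict Implicit.
Unset Printing Implicit Defensive.
Import Order.TTheory GRing.Theory Num.Theory.
Local Open Scope classical_set_scope.
Local Open Scope ring_scope.

(* Indices start at 0, so the usual entry (-1)^(j-1), j = 1..n, is (-1)^j,
   j = 0..n-1. *)
Definition sigma (R : realType) (n : nat) : 'cV[R]_n :=
  \col_(j < n) (-1) ^+ j.

Definition orth (R : realType) (n : nat) (X : set 'cV[R]_n) : set 'cV[R]_n :=
  [set u : 'cV[R]_n | forall v : 'cV[R]_n, X v -> u^T *m v = 0].

(* For even n the index set Z/nZ is represented by 'I_n, and ordS is the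
   cyclic successor i |-> i + 1 mod n.  The sign (-1)^i is well defined modulo n
   because n is even. *)
Definition Meven (R : realType) (n : nat) : set 'M[R]_n :=
  [set M : 'M[R]_n | (forall i j : 'I_n,
              M i j + M i (ordS j) + M (ordS i) j + M (ordS i) (ordS j) = 0)
         /\ \sum_(i < n) \sum_(j < n) (-1) ^+ (i + j) * M i j = 0].

Definition Neven (R : realType) (n : nat) : set 'M[R]_n :=
  [set M : 'M[R]_n | forall j : 'I_n,
             \sum_(i < n) (-1) ^+ i * (M i j + M i (ordS j)) = 0
          /\ \sum_(i < n) (-1) ^+ i * (M j i + M (ordS j) i) = 0].

Definition Modd (R : realType) (n : nat) : set 'M[R]_n :=
  [set M : 'M[R]_n | (forall u v : 'cV[R]_n,
              orth [set sigma R n] u -> orth [set sigma R n] v ->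
              u^T *m M *m v = 0)
         /\ (sigma R n)^T *m M *m sigma R n = 0].

Definition Nodd (R : realType) (n : nat) : set 'M[R]_n :=
  [set M : 'M[R]_n | forall u : 'cV[R]_n, orth [set sigma R n] u ->
             (sigma R n)^T *m M *m u = 0 /\ u^T *m M *m sigma R n = 0].

Arguments Meven : clear implicits.
Arguments Neven : clear implicits.
Arguments Modd : clear implicits.
Arguments Nodd : clear implicits.

Definition Mspace (R : realType) (n : nat) : set 'M[R]_n :=
  if odd n then Modd R n else Meven R n.

Definition Nspace (R : realType) (n : nat) : set 'M[R]_n :=
  if odd n then Nodd R n else Neven R n.

Arguments Mspace : clear implicits.
Arguments Nspace : clear implicits.

Definition setmulmx (R : realType) (n : nat) (X Y : set 'M[R]_n) :
    set 'M[R]_n :=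
  [set x *m y | x in X & y in Y].

(* Main.v *)
(* Write S = sigma sigma^T, so that S^2 = n S; then D = n I - S kills sigma and
   its columns span the orthogonal complement of sigma.  For either parity of n,
   N_n is the commutant of S, while M_n is the set of M with n M = S M + M S: in
   terms of J = n I - 2 S, a multiple of a reflection, these are the matrices
   that commute, respectively anticommute, with J.  The four inclusions are the
   multiplication rules of this Z/2-grading. *)
Require Import Defs.
From HB Require Import structures.
From mathcomp Require Import all_boot all_order all_algebra.
From mathcomp Require Import boolp classical_sets reals.
Set Implicit Arguments.
Unset Strict Implicit.
Unset Printing Implicit Defensive.
Import Order.TTheory GRing.Theory Num.Theory.
Local Open Scope classical_set_scope.
Local Open Scope ring_scope.

Definition sigma_mx (R : realType) (n : nat) : 'M[R]_n :=
  sigma R n *m (sigma R n)^T.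

Definition cosigma_mx (R : realType) (n : nat) : 'M[R]_n :=
  n%:R%:M - sigma_mx R n.

Arguments sigma_mx : clear implicits.
Arguments cosigma_mx : clear implicits.

Lemma sigma_dot (R : realType) (n : nat) :
  (sigma R n)^T *m sigma R n = n%:R%:M.
Proof.
apply/matrixP=> i j; rewrite !ord1 !mxE eqxx mulr1n.
under eq_bigr do rewrite !mxE -exprMn mulrNN mulr1 expr1n.
by rewrite sumr_const card_ord.
Qed.

Lemma sigma_mx_sigma (R : realType) (n : nat) :
  sigma_mx R n *m sigma R n = n%:R *: sigma R n.
Proof. by rewrite -mulmxA sigma_dot mul_mx_scalar. Qed.

Lemma tr_sigma_mx (R : realType) (n : nat) : (sigma_mx R n)^T = sigma_mx R n.
Proof. by rewrite trmx_mul trmxK. Qed.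

Lemma tr_cosigma_mx (R : realType) (n : nat) :
  (cosigma_mx R n)^T = cosigma_mx R n.
Proof. by rewrite linearB /= tr_scalar_mx tr_sigma_mx. Qed.

Lemma mul_cosigma_mx (R : realType) (n m : nat) (X : 'M[R]_(n, m)) :
  cosigma_mx R n *m X = n%:R *: X - sigma_mx R n *m X.
Proof. by rewrite mulmxBl mul_scalar_mx. Qed.

Lemma mulmx_cosigma (R : realType) (n m : nat) (X : 'M[R]_(m, n)) :
  X *m cosigma_mx R n = n%:R *: X - X *m sigma_mx R n.
Proof. by rewrite mulmxBr mul_mx_scalar. Qed.

Lemma cosigma_mx_sigma (R : realType) (n : nat) :
  cosigma_mx R n *m sigma R n = 0.
Proof. by rewrite mul_cosigma_mx sigma_mx_sigma subrr. Qed.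

(** Evenness of [n] matters at the wrap-around: reduction modulo [n] preserves parity. *)
Lemma sigma_ordS (R : realType) (n : nat) (i : 'I_n) : ~~ odd n ->
  sigma R n (ordS i) 0 = - sigma R n i 0.
Proof.
move=> /negbTE en; rewrite !mxE /= -signr_odd odd_mod // signr_odd.
by rewrite exprS mulN1r.
Qed.

(** The rows of D are orthogonal to sigma; conversely u^T S = 0 gives n u^T X = u^T D X. This turns
    the quantified conditions for odd [n] into matrix equations. *)
Lemma orth_sigmaP (R : realType) (n m : nat) (X : 'M[R]_(n, m)) :
  (forall u, orth [set sigma R n] u -> u^T *m X = 0) <->
  cosigma_mx R n *m X = 0.
Proof.
split=> [orthX | DX u].
  apply/row_matrixP=> i; rewrite row_mul row0 -[row i _]trmxK.
  by apply: orthX => _ ->; rewrite trmxK -row_mul cosigma_mx_sigma row0.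
move=> /(_ _ erefl) uS; case: n X u DX uS => [|n] X u DX uS.
  by rewrite [X]flatmx0 mulmx0.
have : n.+1%:R *: (u^T *m X) = 0.
  move/eqP: DX; rewrite mul_cosigma_mx subr_eq0 => /eqP DX.
  by rewrite scalemxAr DX mulmxA mulmxA uS !mul0mx.
by move/eqP; rewrite scaler_eq0 pnatr_eq0 /= => /eqP.
Qed.

(** The counterpart of [orth_sigmaP] for even [n]: both sides say that every column of X is a
    multiple of sigma. Alternation forces X = sigma (row 0 of X), while D X = 0 gives n X = sigma
    (sigma^T X). *)
Lemma cyclic_sigmaP (R : realType) (n m : nat) (X : 'M[R]_(n, m)) :
  ~~ odd n ->
  (forall i j, X i j + X (ordS i) j = 0) <-> cosigma_mx R n *m X = 0.
Proof.
case: n X => [|n] X en; first by split=> [_|_ []//]; apply/matrixP; case.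
split=> [cycX | DX i j].
  suff -> : X = sigma R n.+1 *m row 0 X.
    by rewrite mulmxA cosigma_mx_sigma mul0mx.
  apply/matrixP=> -[i lt_i] j; rewrite mxE big_ord1 !mxE /=.
  elim: i lt_i => [|i IHi] lt_i.
    by rewrite mul1r; congr (X _ _); apply: val_inj.
  have /eqP := cycX (Ordinal (ltnW lt_i)) j.
  rewrite addrC addr_eq0 IHi -mulNr -mulN1r -exprS => /eqP <-.
  by congr (X _ _); apply: val_inj; rewrite /= modn_small.
apply: (mulfI (_ : n.+1%:R != 0 :> R)); first by rewrite pnatr_eq0.
have entry k : n.+1%:R * X k j
    = sigma R n.+1 k 0 * ((sigma R n.+1)^T *m X) 0 j.
  move/eqP: DX; rewrite mul_cosigma_mx subr_eq0 => /eqP/matrixP/(_ k j).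
  by rewrite -mulmxA mxE [RHS]mxE big_ord1.
by rewrite mulrDr mulr0 !entry sigma_ordS // mulNr subrr.
Qed.

(** The form common to both parities: sigma is an eigenvector of M and of M^T. For even [n], the
    defining sums add cyclically adjacent entries of M sigma and M^T sigma. *)
Lemma Nspace_cosigmaP (R : realType) (n : nat) (M : 'M[R]_n) :
  Nspace R n M <->
  cosigma_mx R n *m (M *m sigma R n) = 0 /\
  cosigma_mx R n *m (M^T *m sigma R n) = 0.
Proof.
rewrite /Nspace; case: ifPn => [_ | en].
  rewrite -!orth_sigmaP /Nodd /=; split=> [NM | [MS SM] u ou].
    split=> u /NM[uM Mu]; first by rewrite mulmxA.
    by apply: trmx_inj; rewrite trmx0 !trmx_mul !trmxK.
  split; last by rewrite -mulmxA MS.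
  by apply: trmx_inj; rewrite trmx0 !trmx_mul trmxK SM.
have pair_sum (A : 'M[R]_n) k l :
    \sum_(i < n) (-1) ^+ i * (A k i + A l i)
      = (A *m sigma R n) k 0 + (A *m sigma R n) l 0.
  rewrite !mxE -big_split; apply: eq_bigr => i _.
  by rewrite !mxE /= mulrDr ![_ * (-1) ^+ _]mulrC.
have tr_pair_sum k l : \sum_(i < n) (-1) ^+ i * (M i k + M i l)
    = (M^T *m sigma R n) k 0 + (M^T *m sigma R n) l 0.
  by rewrite -pair_sum; apply: eq_bigr => i _; rewrite !mxE.
rewrite -!cyclic_sigmaP // /Neven /=; split=> [NM | [MS SM] j].
  by split=> j k; rewrite ord1 -?tr_pair_sum -?pair_sum; case: (NM j).
by rewrite pair_sum tr_pair_sum.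
Qed.

Lemma Mspace_cosigmaP (R : realType) (n : nat) (M : 'M[R]_n) :
  Mspace R n M <->
  cosigma_mx R n *m M *m cosigma_mx R n = 0 /\
  (sigma R n)^T *m M *m sigma R n = 0.
Proof.
(* Both criteria treat D as a left factor, so D M D = 0 is transposed into D (D M)^T = 0. *)
have tr_eq0 (A B : 'M[R]_n) : A *m B = 0 <-> B^T *m A^T = 0.
  by rewrite -trmx_mul; split=> [-> | /(congr1 trmx)]; rewrite trmx0 ?trmxK.
rewrite tr_eq0 tr_cosigma_mx /Mspace; case: ifPn => [_ | en].
  rewrite -orth_sigmaP /Modd /=; split=> -[DMD SMS]; split=> // u.
    move=> ou; rewrite trmx_mul tr_cosigma_mx mulmxA; apply: trmx_inj.
    rewrite trmx0 trmx_mul tr_cosigma_mx; apply/orth_sigmaP => v ov.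
    by rewrite trmx_mul !trmxK mulmxA DMD.
  move=> v ou ov.
  have := DMD _ ov; rewrite trmx_mul tr_cosigma_mx mulmxA => /(congr1 trmx).
  rewrite trmx0 trmx_mul tr_cosigma_mx => /orth_sigmaP/(_ _ ou).
  by rewrite trmx_mul !trmxK mulmxA.
have sum_sigma : \sum_(i < n) \sum_(j < n) (-1) ^+ (i + j) * M i j
    = ((sigma R n)^T *m M *m sigma R n) 0 0.
  rewrite -mulmxA mxE; apply: eq_bigr => i _; rewrite !mxE mulr_sumr.
  by apply: eq_bigr => j _; rewrite !mxE exprD -mulrA [M i j * _]mulrC.
rewrite /Meven /= sum_sigma.
(* The four-term sum pairs adjacent rows of M plus its cyclic column shift, so the cyclic criterion
   applies once to rows and then, through the transpose, to columns. *)
have -> : (forall i j : 'I_n, M i j + M i (ordS j) + M (ordS i) j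
      + M (ordS i) (ordS j) = 0)
    <-> cosigma_mx R n *m (M + colsub (@ordS n) M) = 0.
  rewrite -cyclic_sigmaP //.
  by split=> H i j; have := H i j; rewrite !mxE addrA.
have -> : cosigma_mx R n *m (M + colsub (@ordS n) M) = 0 <->
    cosigma_mx R n *m (cosigma_mx R n *m M)^T = 0.
  rewrite -(cyclic_sigmaP (cosigma_mx R n *m M)^T en) mulmxDr.
  rewrite mulmx_colsub.
  split=> [/matrixP H j i | H]; last apply/matrixP=> i j.
    by have := H i j; rewrite !mxE.
  by have := H j i; rewrite !mxE.
split=> -[DMD SMS]; split=> //; last by rewrite SMS mxE.
by apply/matrixP=> i j; rewrite !ord1 SMS mxE.
Qed.

Lemma NspaceP (R : realType) (n : nat) (M : 'M[R]_n) :
  Nspace R n M <-> sigma_mx R n *m M = M *m sigma_mx R n.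
Proof.
rewrite Nspace_cosigmaP; split=> [[] | SM].
  case: n M => [|n] M DM MD; first by apply/matrixP; case.
  have n0 : n.+1%:R != 0 :> R by rewrite pnatr_eq0.
  apply: (scalerI n0).
  (* Applied to M and, after transposition, to M^T, this shows that n M S and n S M both equal S M
     S. *)
  have mulS (A : 'M_n.+1) : cosigma_mx R n.+1 *m (A *m sigma R n.+1) = 0 ->
      cosigma_mx R n.+1 *m (A *m sigma_mx R n.+1) = 0.
    by move=> DA; rewrite /sigma_mx (mulmxA A) mulmxA DA mul0mx.
  move/mulS/eqP: DM; rewrite mul_cosigma_mx subr_eq0 => /eqP ->.
  move/mulS/(congr1 trmx)/eqP: MD; rewrite trmx0 2!trmx_mul trmxK.
  by rewrite tr_sigma_mx tr_cosigma_mx mulmx_cosigma subr_eq0 mulmxA => /eqP.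
have MS : M^T *m sigma_mx R n = sigma_mx R n *m M^T.
  by rewrite -[in LHS]tr_sigma_mx -trmx_mul SM trmx_mul tr_sigma_mx.
rewrite !mul_cosigma_mx !mulmxA SM -MS.
by rewrite -(mulmxA M) -(mulmxA M^T) sigma_mx_sigma -!scalemxAr !subrr.
Qed.

(** Expand D M D = n^2 M - n (S M + M S) + S M S; the last term vanishes with the scalar sigma^T M
    sigma. *)
Lemma MspaceP (R : realType) (n : nat) (M : 'M[R]_n) :
  Mspace R n M <->
  n%:R *: M = sigma_mx R n *m M + M *m sigma_mx R n.
Proof.
rewrite Mspace_cosigmaP.
case: n M => [|n] M.
  by split=> _; [|split]; rewrite [M]flatmx0 ?(mulmx0, mul0mx, scaler0, addr0).
have n0 : n.+1%:R != 0 :> R by rewrite pnatr_eq0.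
have SMSE : sigma_mx R n.+1 *m M *m sigma_mx R n.+1 =
    sigma R n.+1 *m ((sigma R n.+1)^T *m M *m sigma R n.+1)
      *m (sigma R n.+1)^T.
  by rewrite /sigma_mx !mulmxA.
rewrite mul_cosigma_mx mulmxBl -scalemxAl !mulmx_cosigma scalerBr.
split=> [[DMD SMS] | nM].
  apply: (scalerI n0); move/eqP: DMD.
  rewrite SMSE SMS mulmx0 mul0mx subr0 subr_eq0 => /eqP; rewrite scalerDr => <-.
  by rewrite subrK.
(* With q = sigma^T M sigma, sandwiching the hypothesis between sigma^T and sigma gives n q = n q +
   n q. *)
have SMS0 : (sigma R n.+1)^T *m M *m sigma R n.+1 = 0.
  have := congr1 (fun X => (sigma R n.+1)^T *m X *m sigma R n.+1) nM.
  rewrite mulmxDr mulmxDl -scalemxAr -scalemxAl !mulmxA sigma_dot.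
  rewrite -[_ *m M *m sigma R n.+1 *m _ *m _]mulmxA sigma_dot.
  rewrite mul_scalar_mx mul_mx_scalar -!scalemxAl => /eqP.
  rewrite -subr_eq0 opprD addrA subrr sub0r oppr_eq0 scaler_eq0.
  by rewrite (negbTE n0) => /eqP.
by split=> //; rewrite SMSE SMS0 mulmx0 mul0mx subr0 nM scalerDr addrK subrr.
Qed.

Theorem theorem10 (R : realType) (n : nat) :
  [/\ setmulmx (Nspace R n) (Nspace R n) `<=` Nspace R n,
      setmulmx (Mspace R n) (Mspace R n) `<=` Nspace R n,
      setmulmx (Mspace R n) (Nspace R n) `<=` Mspace R n
    & setmulmx (Nspace R n) (Mspace R n) `<=` Mspace R n].
Proof.
split=> _ [A AP [B BP <-]]; move: AP BP.
- by rewrite !NspaceP => SA SB; rewrite mulmxA SA -mulmxA SB mulmxA.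
- rewrite !MspaceP NspaceP => nA nB.
  (* Both S A B and A B S equal n A B - A S B. *)
  have -> : sigma_mx R n *m (A *m B)
      = n%:R *: A *m B - A *m (sigma_mx R n *m B).
    by rewrite nA mulmxDl !mulmxA addrK.
  by rewrite -scalemxAl scalemxAr nB mulmxDr [_ + A *m _]addrC addrK mulmxA.
- rewrite !MspaceP NspaceP => nA SB.
  by rewrite scalemxAl nA mulmxDl -(mulmxA A) SB !mulmxA.
- rewrite !MspaceP NspaceP => SA nB.
  by rewrite scalemxAr nB mulmxDr (mulmxA A _ B) -SA !mulmxA.
Qed.
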